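(* Let $X$ be a non-empty set and $i\in\{ls,rs,s,p\}$. Let $\mathsf{FFBR}_{ls}(X)$, $\mathsf{FFBR}_{rs}(X)$, $\mathsf{FFBR}_{s}(X)$, $\mathsf{FFBR}_{p}(X)$ be the free $X$-generated left strong, right strong, strong and perfect $F$-birestriction monoids, respectively. Then the map $x\mapsto (x^+,x)$, $x\in X$, extends to an $X$-canonical $(2,1,1,1,0)$-isomorphism $$\mathsf{FFBR}_i(X)\simeq E(\mathcal I_i)\rtimes X^* .$$
   Context: A birestriction monoid is an algebra $(S;\cdot,{}^*,{}^+,1)$ such that $(S;\cdot,1)$ is a monoid and for all $x,y$: $xx^*=x$, $x^*y^*=y^*x^*$, $(xy^* )^*=x^*y^*$, $x^*y=y(xy)^*$; $x^+x=x$, $x^+y^+=y^+x^+$, $(x^+y)^+=x^+y^+$, $xy^+=(xy)^+x$; $(x^+)^*=x^+$, $(x^* )^+=x^*$. Its projections are $P(S)=\{s^*:s\in S\}=\{s^+:s\in S\}$; $s\le t$ iff $s=et$ for some $e\in P(S)$; $s\mathrel{\sigma}t$ iff $se=te$ for some $e\in P(S)$. An $F$-birestriction monoid is a birestriction monoid in which every $\sigma$-class has a maximum element with respect to $\le$; $s^{\mathfrak m}$ denotes the maximum element of the $\sigma$-class of $s$. $F$-birestriction monoids are regarded as algebras $(S;\cdot,{}^*,{}^+,{}^{\mathfrak m},1)$ of type $(2,1,1,1,0)$. Such a monoid is left strong if it satisfies $x^{\mathfrak m}y^{\mathfrak m}=(x^{\mathfrak m})^+(xy)^{\mathfrak m}$,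 right strong if it satisfies $x^{\mathfrak m}y^{\mathfrak m}=(xy)^{\mathfrak m}(y^{\mathfrak m})^*$, strong if it is both left and right strong, and perfect if it satisfies $x^{\mathfrak m}y^{\mathfrak m}=(xy)^{\mathfrak m}$. Each class is a variety, and $\mathsf{FFBR}_i(X)$ denotes its free algebra on $X$. An isomorphism is $X$-canonical if it commutes with the assignment maps from $X$. $X^+$, $X^*$ are the free semigroup and free monoid on $X$; $\overline{X^+}=\{\overline{u}:u\in X^+\}$ is a set disjoint from $X$ in bijection with $X^+$. In an inverse monoid $a^*=a^{-1}a$, $a^+=aa^{-1}$, $E(\cdot)$ is the semilattice of idempotents, and a relation $a\ge b$ abbreviates $b=ab^*$. Put $N_{ls}=\{\overline{x}\ge x,\ \overline{u}\,\overline{v}=\overline{u}^{\,+}\overline{uv}: x\in X,\ u,v\in X^+\}$, $N_{rs}=\{\overline{x}\ge x,\ \overline{u}\,\overline{v}=\overline{uv}\,\overline{v}^{\,*}: x\in X,\ u,v\in X^+\}$, $N_s=N_{ls}\cup N_{rs}$, $N_p=\{\overline{x}\ge x,\ \overline{uv}=\overline{u}\,\overline{v}: x\in X,\ u,v\in X^+\}$, and let $\mathcal I_i=\mathrm{Inv}\langle X\cup\overline{X^+}\mid N_i\rangle$ be the inverse monoid with this presentation. The symbols $x,\overline{u}$ also denote their values in $\mathcal I_i$, and $\overline{1}=1$. The partial action product $E(\mathcal I_i)\rtimes X^*$ is taken with respect to the partial action of $X^*$ on $E(\mathcal I_i)$ in which $u\in X^*$ acts by the order isomorphism $\varphi_u$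 with domain $\{e: e\le \overline{u}^{\,*}\}$, range $\{e:e\le\overline{u}^{\,+}\}$ and $\varphi_u(e)=(\overline{u}e)^+$. Explicitly, $E(\mathcal I_i)\rtimes X^*=\{(e,u)\in E(\mathcal I_i)\times X^*: e\le\overline{u}^{\,+}\}$ with identity $(1,1)$ and $(e,u)(f,v)=(e(\overline{u}f)^+,uv)$, $(e,u)^*=((e\overline{u})^*,1)$, $(e,u)^+=(e,1)$, $(e,u)^{\mathfrak m}=(\overline{u}^{\,+},u)$. *)

(* Defs.v *)
From HB Require Import structures.
From mathcomp Require Import all_boot.
From mathcomp Require Import boolp classical_sets.

Set Implicit Arguments.
Unset Strict Implicit.
Unset Printing Implicit Defensive.

Local Open Scope classical_set_scope.
Local Open Scope quotient_scope.
Local Open Scope group_scope.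

(* Algebras of type (2,1,1,1,0), without axioms: bstar x, bplus x and bmax x   *)
(* are x^*, x^+ and x^m.                                                      *)
HB.mixin Record hasBirestrictionOps S := {
  bstar : S -> S;
  bplus : S -> S;
  bmax : S -> S
}.

#[short(type="fbrAlgType")]
HB.structure Definition FBRAlgebra := {S of hasBirestrictionOps S & BaseUMagma S}.

Record fbr_hom (S T : fbrAlgType) (h : S -> T) : Prop := FBRHom {
  fbr_homM : {morph h : x y / x * y};
  fbr_hom_star : {morph h : x / bstar x};
  fbr_hom_plus : {morph h : x / bplus x};
  fbr_hom_max : {morph h : x / bmax x};
  fbr_hom1 : h 1 = 1
}.

Record birestriction_monoid (S : fbrAlgType) : Prop := BirestrictionMonoid {
  bmulA : forall x y z : S, x * (y * z) = x * y * z;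
  bmul1 : forall x : S, 1 * x = x;
  bmulx1 : forall x : S, x * 1 = x;
  bmul_star : forall x : S, x * bstar x = x;
  bstarC : forall x y : S, bstar x * bstar y = bstar y * bstar x;
  bstarM : forall x y : S, bstar (x * bstar y) = bstar x * bstar y;
  bstar_mul : forall x y : S, bstar x * y = y * bstar (x * y);
  bplus_mul : forall x : S, bplus x * x = x;
  bplusC : forall x y : S, bplus x * bplus y = bplus y * bplus x;
  bplusM : forall x y : S, bplus (bplus x * y) = bplus x * bplus y;
  bmul_plus : forall x y : S, x * bplus y = bplus (x * y) * x;
  bplus_star : forall x : S, bstar (bplus x) = bplus x;
  bstar_plus : forall x : S, bplus (bstar x) = bstar x
}.

Definition proj (S : fbrAlgType) : set S := range (@bstar S).

Definition ble (S : fbrAlgType) (s t : S) : Prop :=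
  exists2 e, proj e & s = e * t.

Definition bsigma (S : fbrAlgType) (s t : S) : Prop :=
  exists2 e, proj e & s * e = t * e.

Definition F_birestriction_monoid (S : fbrAlgType) : Prop :=
  birestriction_monoid S /\
  forall s : S, bsigma s (bmax s) /\ forall t : S, bsigma s t -> ble t (bmax s).

Lemma F_birestriction_equations (S : fbrAlgType) :
  F_birestriction_monoid S <->
  [/\ birestriction_monoid S, forall x : S, bplus x * bmax x = x &
      forall x y : S, bmax (x * bstar y) = bmax x].
Proof.
split=> [[bS FS]|[bS plus_max max_star]].
- have bplus_proj (x : S) : proj (bplus x).
    by exists (bplus x); rewrite // bplus_star.
  have plus_le (x y : S) : ble x y -> x = bplus x * y.
    move=> [e [z _ <-] xzy].
    have plus_x : bplus x = bstar z * bplus y.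
      by rewrite xzy -[bstar z](bstar_plus bS) (bplusM bS).
    by rewrite plus_x -(bmulA bS) (bplus_mul bS).
  have sigma_sym (x y : S) : bsigma x y -> bsigma y x.
    by move=> [e pe xy]; exists e.
  have projM (e g : S) : proj e -> proj g -> proj (e * g).
    by move=> [z _ <-] [w _ <-]; exists (z * bstar w); rewrite // (bstarM bS).
  have projC (e g : S) : proj e -> proj g -> e * g = g * e.
    by move=> [z _ <-] [w _ <-]; rewrite (bstarC bS).
  have sigma_trans (x y z : S) : bsigma x y -> bsigma y z -> bsigma x z.
    move=> [e pe xy] [g pg yz]; exists (e * g); first exact: projM.
    rewrite (bmulA bS) xy -(bmulA bS) (projC e g) // (bmulA bS) yz.
    by rewrite -(bmulA bS).
  have sigma_refl (x : S) : bsigma x x by exists (bplus x).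
  have proj_idem (e : S) : proj e -> e * e = e.
    by move=> [z _ <-]; rewrite -(bstarM bS) (bmul_star bS).
  have le_anti (x y : S) : ble x y -> ble y x -> x = y.
    move=> /plus_le xy /plus_le yx.
    rewrite {1}xy {1}yx (bmulA bS) (bplusC bS) -(bmulA bS) (bplus_mul bS).
    by rewrite -yx.
  have max_eq (x y : S) : bsigma x y -> bmax x = bmax y.
    move=> xy; have [sx mx] := FS x; have [sy my] := FS y.
    apply: le_anti; first by apply: my; apply: sigma_trans sx; exact: sigma_sym.
    by apply: mx; exact: sigma_trans sy.
  split=> // [x|x y].
    by symmetry; apply: plus_le; apply: (FS x).2.
  by apply: max_eq; exists (bstar y);
    [exists y | rewrite -(bmulA bS) (proj_idem (bstar y)) //; exists y].
- split=> // s; split.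
    exists (bstar s); first by exists s.
    have := bstar_mul bS (bplus s) (bmax s).
    by rewrite (bplus_star bS) (plus_max s) (bmul_star bS).
  move=> t [e [z _ <-] st]; exists (bplus t); first by exists (bplus t); rewrite // bplus_star.
  by rewrite -(max_star s z) st max_star plus_max.
Qed.

Definition left_strong (S : fbrAlgType) : Prop :=
  forall x y : S, bmax x * bmax y = bplus (bmax x) * bmax (x * y).

Definition right_strong (S : fbrAlgType) : Prop :=
  forall x y : S, bmax x * bmax y = bmax (x * y) * bstar (bmax y).

Definition perfect (S : fbrAlgType) : Prop :=
  forall x y : S, bmax x * bmax y = bmax (x * y).

Inductive strength := LeftStrong | RightStrong | Strong | Perfect.

Definition strength_axiom (i : strength) (S : fbrAlgType) : Prop :=
  match i with
  | LeftStrong => left_strong S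
  | RightStrong => right_strong S
  | Strong => left_strong S /\ right_strong S
  | Perfect => perfect S
  end.

Definition in_variety (i : strength) (S : fbrAlgType) : Prop :=
  F_birestriction_monoid S /\ strength_axiom i S.

(* The term algebra on X modulo the identities that hold in every member of   *)
(* the variety i; ffbr_free is its universal property.                        *)
Inductive fbr_term (X : Type) :=
| FVar of X
| FMul of fbr_term X & fbr_term X
| FStar of fbr_term X
| FPlus of fbr_term X
| FMax of fbr_term X
| FOne.
Arguments FOne {X}.

HB.instance Definition _ (X : Type) := gen_eqMixin (fbr_term X).
HB.instance Definition _ (X : Type) := gen_choiceMixin (fbr_term X).

Fixpoint fbr_eval (X : Type) (S : fbrAlgType) (f : X -> S) (t : fbr_term X) : S :=
  match t with
  | FVar x => f x
  | FMul s t => fbr_eval f s * fbr_eval f t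
  | FStar s => bstar (fbr_eval f s)
  | FPlus s => bplus (fbr_eval f s)
  | FMax s => bmax (fbr_eval f s)
  | FOne => 1
  end.

Section FreeAlgebra.
Variables (i : strength) (X : Type).

Definition fbr_identity (s t : fbr_term X) : Prop :=
  forall S : fbrAlgType, in_variety i S ->
  forall f : X -> S, fbr_eval f s = fbr_eval f t.

Definition fbr_eq : rel (fbr_term X) := fun s t => `[< fbr_identity s t >].

Lemma fbr_eq_refl : reflexive fbr_eq.
Proof. by move=> t; apply/asboolP. Qed.

Lemma fbr_eq_sym : symmetric fbr_eq.
Proof.
by move=> s t; apply/asboolP/asboolP => st S VS f; rewrite (st S VS f).
Qed.

Lemma fbr_eq_trans : transitive fbr_eq.
Proof.
move=> t s u /asboolP st /asboolP tu; apply/asboolP => S VS f.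
by rewrite (st S VS f) (tu S VS f).
Qed.

Definition fbr_equiv := EquivRel fbr_eq fbr_eq_refl fbr_eq_sym fbr_eq_trans.

Definition FFBR : Type := {eq_quot fbr_equiv}.
HB.instance Definition _ := Choice.on FFBR.
HB.instance Definition _ := EqQuotient.on FFBR.

Definition ffbr_class (t : fbr_term X) : FFBR := \pi_FFBR t.

HB.instance Definition _ :=
  hasMul.Build FFBR (fun a b => ffbr_class (FMul (repr a) (repr b))).
HB.instance Definition _ := hasOne.Build FFBR (ffbr_class FOne).
HB.instance Definition _ := hasBirestrictionOps.Build FFBR
  (fun a => ffbr_class (FStar (repr a)))
  (fun a => ffbr_class (FPlus (repr a)))
  (fun a => ffbr_class (FMax (repr a))).

Definition ffbr_gen (x : X) : FFBR := ffbr_class (FVar x).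

End FreeAlgebra.

Section FreeAlgebraTheory.
Variables (i : strength) (X : Type).
Implicit Types (s t : fbr_term X) (a b : FFBR i X).

Lemma ffbr_classP s t :
  ffbr_class i s = ffbr_class i t <-> fbr_identity i s t.
Proof.
split=> [/eqmodP|] st; first exact/asboolP.
by apply/eqmodP/asboolP.
Qed.

Lemma ffbr_repr a : ffbr_class i (repr a) = a.
Proof. exact: reprK. Qed.

Section Evaluation.
Variables (S : fbrAlgType) (VS : in_variety i S) (f : X -> S).

Definition ffbr_eval a : S := fbr_eval f (repr a).

Lemma ffbr_eval_class t : ffbr_eval (ffbr_class i t) = fbr_eval f t.
Proof. by apply: (_ : fbr_identity i _ _) => //; apply/ffbr_classP; exact: ffbr_repr. Qed.

Lemma ffbr_eval_hom : fbr_hom ffbr_eval.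
Proof. by split=> [a b|a|a|a|]; rewrite ffbr_eval_class. Qed.

End Evaluation.

Lemma ffbr_ext a b :
  (forall S : fbrAlgType, in_variety i S -> forall f : X -> S,
     ffbr_eval f a = ffbr_eval f b) -> a = b.
Proof.
by move=> ab; rewrite -(ffbr_repr a) -(ffbr_repr b); apply/ffbr_classP => S /ab.
Qed.

Lemma ffbr_in_variety : in_variety i (FFBR i X).
Proof.
have homE (S : fbrAlgType) (VS : in_variety i S) (f : X -> S) :=
  let h := ffbr_eval_hom VS f in
  (fbr_homM h, fbr_hom_star h, fbr_hom_plus h, fbr_hom_max h, fbr_hom1 h).
split.
  apply/F_birestriction_equations; split.
  - split=> *; apply: ffbr_ext => S VS f; rewrite !(homE S VS f);
      have [[bS _] _] := VS.
    + exact: bmulA.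
    + exact: bmul1.
    + exact: bmulx1.
    + exact: bmul_star.
    + exact: bstarC.
    + exact: bstarM.
    + exact: bstar_mul.
    + exact: bplus_mul.
    + exact: bplusC.
    + exact: bplusM.
    + exact: bmul_plus.
    + exact: bplus_star.
    + exact: bstar_plus.
  - move=> x; apply: ffbr_ext => S VS f; rewrite !(homE S VS f).
    by have [/F_birestriction_equations[]] := VS.
  - move=> x y; apply: ffbr_ext => S VS f; rewrite !(homE S VS f).
    by have [/F_birestriction_equations[]] := VS.
suff axiomP j : (forall S, in_variety i S -> strength_axiom j S) ->
    strength_axiom j (FFBR i X) by apply: axiomP => S [].
case: j => [ls|rs|s|p]; [| |split|]; move=> x y; apply: ffbr_ext => S VS f;
  rewrite !(homE S VS f).
- exact: (ls S VS).
- exact: (rs S VS).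
- exact: (s S VS).1.
- exact: (s S VS).2.
- exact: (p S VS).
Qed.

Theorem ffbr_free :
  in_variety i (FFBR i X) /\
  forall (S : fbrAlgType) (f : X -> S), in_variety i S ->
    exists! h : FFBR i X -> S, fbr_hom h /\ forall x, h (ffbr_gen i x) = f x.
Proof.
split=> [|S f VS]; first exact: ffbr_in_variety.
exists (ffbr_eval f); split.
  by split=> [|x]; [exact: ffbr_eval_hom | rewrite ffbr_eval_class].
move=> h [hh hf]; apply/funext => a.
have classE t : h (ffbr_class i t) = fbr_eval f t.
  elim: t => [x|s IHs t IHt|s IHs|s IHs|s IHs|] /=; first exact: hf.
  - rewrite -IHs -IHt -(fbr_homM hh); congr h; apply/ffbr_classP => T VT g /=.
    by rewrite -!(ffbr_eval_class VT g) !ffbr_repr.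
  - rewrite -IHs -(fbr_hom_star hh); congr h; apply/ffbr_classP => T VT g /=.
    by rewrite -!(ffbr_eval_class VT g) !ffbr_repr.
  - rewrite -IHs -(fbr_hom_plus hh); congr h; apply/ffbr_classP => T VT g /=.
    by rewrite -!(ffbr_eval_class VT g) !ffbr_repr.
  - rewrite -IHs -(fbr_hom_max hh); congr h; apply/ffbr_classP => T VT g /=.
    by rewrite -!(ffbr_eval_class VT g) !ffbr_repr.
  - exact: (fbr_hom1 hh).
by rewrite -{2}(ffbr_repr a) classE.
Qed.

End FreeAlgebraTheory.

HB.mixin Record StarMonoid_isInverse M of StarMonoid M := {
  mulgVKg : forall x : M, x * x^-1 * x = x;
  mulgVC : forall x y : M, commute (x * x^-1) (y * y^-1)
}.

#[short(type="inverseMonoidType")]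
HB.structure Definition InverseMonoid := {M of StarMonoid_isInverse M & StarMonoid M}.

(* istar, iplus and ige are also used on the term algebra invterm, hence     *)
(* the weak structure; for idempotents, ige f e is e <= f.                    *)
Definition istar (M : baseGroupType) (a : M) : M := a^-1 * a.
Definition iplus (M : baseGroupType) (a : M) : M := a * a^-1.

Definition ige (M : baseGroupType) (a b : M) : Prop := b = a * istar b.

Definition idem (M : baseGroupType) : set M := [set e | e * e = e].

Section InverseMonoidTheory.
Variable M : inverseMonoidType.
Implicit Types a b e f : M.

Lemma iplus_mul a : iplus a * a = a.
Proof. exact: mulgVKg. Qed.

Lemma iplusC a b : iplus a * iplus b = iplus b * iplus a.
Proof. exact: mulgVC. Qed.

Lemma istar_iplus a : istar a = iplus a^-1.
Proof. by rewrite /istar /iplus invgK. Qed.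

Lemma idem_iplus a : idem (iplus a).
Proof. by rewrite /idem /= /iplus mulgA mulgVKg. Qed.

Lemma idem_istar a : idem (istar a).
Proof. by rewrite istar_iplus; exact: idem_iplus. Qed.

Lemma idem_inv e : idem e -> e^-1 = e.
Proof.
rewrite /idem /= => ee; have eVV : e^-1 * e^-1 = e^-1 by rewrite -invgM ee.
have VeV : e^-1 * e * e^-1 = e^-1 by have := mulgVKg e^-1; rewrite invgK.
have eC : e^-1 * e * (e * e^-1) = e * e^-1 * (e^-1 * e).
  by have := mulgVC e^-1 e; rewrite /commute invgK.
transitivity (e^-1 * e * (e * e^-1)); first by rewrite mulgA -(mulgA _ e e) ee VeV.
by rewrite eC mulgA -(mulgA e) eVV mulgVKg.
Qed.

Lemma istar_idem e : idem e -> istar e = e.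
Proof. by move=> ee; rewrite /istar idem_inv. Qed.

Lemma iplus_idem e : idem e -> iplus e = e.
Proof. by move=> ee; rewrite /iplus idem_inv. Qed.

Lemma idemC e f : idem e -> idem f -> e * f = f * e.
Proof. by move=> /iplus_idem <- /iplus_idem <-; exact: iplusC. Qed.

Lemma idemM e f : idem e -> idem f -> idem (e * f).
Proof.
move=> ee ff; rewrite /idem /= mulgA -(mulgA e) (idemC ff ee) mulgA ee -mulgA.
by rewrite ff.
Qed.

Lemma ige_idem e f : idem f -> ige e f <-> e * f = f.
Proof. by move=> /istar_idem ff; rewrite /ige ff; split=> /esym. Qed.

Lemma iplus1 : iplus 1 = 1 :> M.
Proof. by rewrite /iplus invg1 mulg1. Qed.

Lemma ige1 e : idem e -> ige (iplus 1) e.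
Proof. by move=> ee; apply/ige_idem; rewrite // iplus1 mul1g. Qed.

End InverseMonoidTheory.

Inductive invterm (A : Type) :=
| IVar of A
| IMul of invterm A & invterm A
| IInv of invterm A
| IOne.
Arguments IOne {A}.

HB.instance Definition _ (A : Type) := gen_eqMixin (invterm A).
HB.instance Definition _ (A : Type) := gen_choiceMixin (invterm A).
HB.instance Definition _ (A : Type) := hasMul.Build (invterm A) (@IMul A).
HB.instance Definition _ (A : Type) := hasOne.Build (invterm A) IOne.
HB.instance Definition _ (A : Type) := hasInv.Build (invterm A) (@IInv A).

Fixpoint inv_eval (A : Type) (M : baseGroupType) (f : A -> M) (t : invterm A) : M :=
  match t with
  | IVar a => f a
  | IMul s t => inv_eval f s * inv_eval f t
  | IInv s => (inv_eval f s)^-1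
  | IOne => 1
  end.

Section Presentation.
Variables (A : Type) (N : invterm A -> invterm A -> Prop).
Implicit Types s t u : invterm A.

(* The least congruence on terms that contains N and the identities defining  *)
(* inverse monoids; Inv is the inverse monoid with presentation <A | N>.      *)
Inductive inv_cong : invterm A -> invterm A -> Prop :=
| IC_rel s t : N s t -> inv_cong s t
| IC_refl t : inv_cong t t
| IC_sym s t : inv_cong s t -> inv_cong t s
| IC_trans s t u : inv_cong s t -> inv_cong t u -> inv_cong s u
| IC_mul s s' t t' : inv_cong s s' -> inv_cong t t' -> inv_cong (s * t) (s' * t')
| IC_inv s s' : inv_cong s s' -> inv_cong s^-1 s'^-1
| IC_mulA s t u : inv_cong (s * (t * u)) (s * t * u)
| IC_mul1 t : inv_cong (1 * t) t
| IC_mulx1 t : inv_cong (t * 1) t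
| IC_invK t : inv_cong t^-1^-1 t
| IC_invM s t : inv_cong (s * t)^-1 (t^-1 * s^-1)
| IC_mulVK t : inv_cong (t * t^-1 * t) t
| IC_mulVC s t : inv_cong (s * s^-1 * (t * t^-1)) (t * t^-1 * (s * s^-1)).

Definition inv_eq : rel (invterm A) := fun s t => `[< inv_cong s t >].

Lemma inv_eq_refl : reflexive inv_eq.
Proof. by move=> t; apply/asboolP; exact: IC_refl. Qed.

Lemma inv_eq_sym : symmetric inv_eq.
Proof. by move=> s t; apply/asboolP/asboolP; exact: IC_sym. Qed.

Lemma inv_eq_trans : transitive inv_eq.
Proof.
by move=> t s u /asboolP st /asboolP tu; apply/asboolP; exact: IC_trans tu.
Qed.

Definition inv_equiv := EquivRel inv_eq inv_eq_refl inv_eq_sym inv_eq_trans.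

Definition Inv : Type := {eq_quot inv_equiv}.
HB.instance Definition _ := Choice.on Inv.
HB.instance Definition _ := EqQuotient.on Inv.

Definition inv_class (t : invterm A) : Inv := \pi_Inv t.

Definition Inv_mul (a b : Inv) : Inv := inv_class (repr a * repr b).
Definition Inv_inv (a : Inv) : Inv := inv_class (repr a)^-1.

Lemma inv_classP s t : inv_class s = inv_class t <-> inv_cong s t.
Proof.
split=> [/eqmodP|] st; first exact/asboolP.
by apply/eqmodP/asboolP.
Qed.

Lemma Inv_reprK t : inv_cong (repr (inv_class t)) t.
Proof. by apply/inv_classP; exact: reprK. Qed.

Lemma Inv_classM s t : Inv_mul (inv_class s) (inv_class t) = inv_class (s * t).
Proof. by apply/inv_classP/IC_mul; exact: Inv_reprK. Qed.

Lemma Inv_classV t : Inv_inv (inv_class t) = inv_class t^-1.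
Proof. by apply/inv_classP/IC_inv; exact: Inv_reprK. Qed.

Lemma Inv_ind (P : Inv -> Prop) : (forall t, P (inv_class t)) -> forall a, P a.
Proof. by move=> Pt a; rewrite -[a]reprK; exact: Pt. Qed.

Lemma Inv_mulA : associative Inv_mul.
Proof.
elim/Inv_ind=> s; elim/Inv_ind=> t; elim/Inv_ind=> u; rewrite !Inv_classM.
by apply/inv_classP; exact: IC_mulA.
Qed.

Lemma Inv_mul1 : left_id (inv_class 1) Inv_mul.
Proof.
by elim/Inv_ind=> t; rewrite Inv_classM; apply/inv_classP; exact: IC_mul1.
Qed.

Lemma Inv_mulx1 : right_id (inv_class 1) Inv_mul.
Proof.
by elim/Inv_ind=> t; rewrite Inv_classM; apply/inv_classP; exact: IC_mulx1.
Qed.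

Lemma Inv_invK : involutive Inv_inv.
Proof.
by elim/Inv_ind=> t; rewrite !Inv_classV; apply/inv_classP; exact: IC_invK.
Qed.

Lemma Inv_invM : {morph Inv_inv : a b / Inv_mul a b >-> Inv_mul b a}.
Proof.
elim/Inv_ind=> s; elim/Inv_ind=> t; rewrite !(Inv_classM, Inv_classV).
by apply/inv_classP; exact: IC_invM.
Qed.

HB.instance Definition _ := isMonoid.Build Inv Inv_mulA Inv_mul1 Inv_mulx1.
HB.instance Definition _ := hasInv.Build Inv Inv_inv.
HB.instance Definition _ := Monoid_isStarMonoid.Build Inv Inv_invK Inv_invM.

Lemma inv_classM s t : inv_class (s * t) = inv_class s * inv_class t.
Proof. by rewrite -Inv_classM. Qed.

Lemma inv_classV t : inv_class t^-1 = (inv_class t)^-1.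
Proof. by rewrite -Inv_classV. Qed.

Lemma inv_class_istar t : inv_class (istar t) = istar (inv_class t).
Proof. by rewrite /istar -inv_classV inv_classM. Qed.

Lemma inv_class_iplus t : inv_class (iplus t) = iplus (inv_class t).
Proof. by rewrite /iplus -inv_classV inv_classM. Qed.

Lemma inv_class1 : inv_class 1 = 1.
Proof. by []. Qed.

Lemma Inv_mulVK (a : Inv) : a * a^-1 * a = a.
Proof.
elim/Inv_ind: a => t; rewrite -inv_classV -!inv_classM.
by apply/inv_classP; exact: IC_mulVK.
Qed.

Lemma Inv_mulVC (a b : Inv) : commute (a * a^-1) (b * b^-1).
Proof.
elim/Inv_ind: a => s; elim/Inv_ind: b => t; rewrite /commute.
rewrite -!inv_classV -!inv_classM.
by apply/inv_classP; exact: IC_mulVC.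
Qed.

HB.instance Definition _ := StarMonoid_isInverse.Build Inv Inv_mulVK Inv_mulVC.

Lemma inv_class_rel s t : N s t -> inv_class s = inv_class t.
Proof. by move=> /IC_rel st; apply/inv_classP. Qed.

Lemma Inv_universal (M : inverseMonoidType) (f : A -> M) :
  (forall s t, N s t -> inv_eval f s = inv_eval f t) ->
  forall s t, inv_class s = inv_class t -> inv_eval f s = inv_eval f t.
Proof.
move=> Nf s t /inv_classP; elim=> {s t} //=.
- by move=> s t u _ -> _ ->.
- by move=> s s' t t' _ -> _ ->.
- by move=> s s' _ ->.
- by move=> s t u; rewrite mulgA.
- by move=> t; rewrite mul1g.
- by move=> t; rewrite mulg1.
- by move=> t; rewrite invgK.
- by move=> s t; rewrite invgM.
- by move=> t; rewrite mulgVKg.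
- by move=> s t; rewrite mulgVC.
Qed.

End Presentation.

(* Bar x w is the letter \overline{xw}; thus X^+ is encoded as X * X^*. *)
Inductive letter (X : Type) := Letter of X | Bar of X & seq X.

Definition lett (X : Type) (x : X) : invterm (letter X) := IVar (Letter x).

Definition bar (X : Type) (u : seq X) : invterm (letter X) :=
  if u is x :: w then IVar (Bar x w) else 1.

(* In N_ls, N_rs and N_p, the relation \overline{x} >= x is written out, cf   *)
(* ige, as the pair with sides x and \overline{x} x^*.                        *)
Inductive N_ls (X : Type) : invterm (letter X) -> invterm (letter X) -> Prop :=
| N_ls_ge x : N_ls (lett x) (bar [:: x] * istar (lett x))
| N_ls_mul u v : u <> [::] -> v <> [::] ->
    N_ls (bar u * bar v) (iplus (bar u) * bar (u ++ v)).

Inductive N_rs (X : Type) : invterm (letter X) -> invterm (letter X) -> Prop :=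
| N_rs_ge x : N_rs (lett x) (bar [:: x] * istar (lett x))
| N_rs_mul u v : u <> [::] -> v <> [::] ->
    N_rs (bar u * bar v) (bar (u ++ v) * istar (bar v)).

Inductive N_p (X : Type) : invterm (letter X) -> invterm (letter X) -> Prop :=
| N_p_ge x : N_p (lett x) (bar [:: x] * istar (lett x))
| N_p_mul u v : u <> [::] -> v <> [::] ->
    N_p (bar (u ++ v)) (bar u * bar v).

Definition N (i : strength) (X : Type) (s t : invterm (letter X)) : Prop :=
  match i with
  | LeftStrong => N_ls s t
  | RightStrong => N_rs s t
  | Strong => N_ls s t \/ N_rs s t
  | Perfect => N_p s t
  end.

Definition I_ (i : strength) (X : Type) : inverseMonoidType := Inv (@N i X).

Definition Ilett (i : strength) (X : Type) (x : X) : I_ i X :=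
  inv_class (@N i X) (lett x).

Definition Ibar (i : strength) (X : Type) (u : seq X) : I_ i X :=
  inv_class (@N i X) (bar u).

(* The partial action is defined on e <= \overline{u}^* only; the product     *)
(* below uses the same formula for any e.                                     *)
Definition paction (i : strength) (X : Type) (u : seq X) (e : I_ i X) : I_ i X :=
  iplus (Ibar i u * e).

Definition pap_set (i : strength) (X : Type) : set (I_ i X * seq X) :=
  [set p | idem p.1 /\ ige (iplus (Ibar i p.2)) p.1].

Section PartialActionProduct.
Variables (i : strength) (X : Type).
Implicit Types (e f : I_ i X) (u v : seq X) (x : X).

Lemma Ilett_ge x : ige (Ibar i [:: x]) (Ilett i x).
Proof.
rewrite /ige /Ilett /Ibar -inv_class_istar -inv_classM.
apply: inv_class_rel.
by case: i; [| |left|]; constructor.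
Qed.

Lemma iplus_bar_mul u v :
  iplus (Ibar i (u ++ v)) * (Ibar i u * Ibar i v) = Ibar i u * Ibar i v.
Proof.
case: u => [|x u].
  by rewrite -[Ibar i [::]]inv_class1 mul1g iplus_mul.
case: v => [|y v].
  by rewrite cats0 -[Ibar i [::]]inv_class1 mulg1 iplus_mul.
have ls : N_ls (bar (x :: u) * bar (y :: v))
    (iplus (bar (x :: u)) * bar ((x :: u) ++ y :: v)) by constructor.
have lsE : Ibar i (x :: u) * Ibar i (y :: v)
    = iplus (Ibar i (x :: u)) * Ibar i ((x :: u) ++ y :: v) ->
    iplus (Ibar i ((x :: u) ++ y :: v)) * (Ibar i (x :: u) * Ibar i (y :: v))
    = Ibar i (x :: u) * Ibar i (y :: v).
  by move=> ->; rewrite mulgA iplusC -mulgA iplus_mul.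
case Ei: i lsE => lsE.
- by apply: lsE; rewrite /Ibar -inv_class_iplus -!inv_classM; exact: inv_class_rel.
- have -> : Ibar RightStrong (x :: u) * Ibar RightStrong (y :: v)
      = Ibar RightStrong ((x :: u) ++ y :: v) * istar (Ibar RightStrong (y :: v)).
    rewrite /Ibar -inv_class_istar -!inv_classM; apply: inv_class_rel.
    exact: N_rs_mul.
  by rewrite mulgA iplus_mul.
- apply: lsE; rewrite /Ibar -inv_class_iplus -!inv_classM; apply: inv_class_rel.
  by left.
- have -> : Ibar Perfect (x :: u) * Ibar Perfect (y :: v)
      = Ibar Perfect ((x :: u) ++ y :: v).
    by rewrite /Ibar -!inv_classM; symmetry; apply: inv_class_rel; exact: N_p_mul.
  by rewrite iplus_mul.
Qed.

Lemma pap_mulP (p q : I_ i X * seq X) :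
  pap_set p -> pap_set q ->
  pap_set (p.1 * paction p.2 q.1, p.2 ++ q.2).
Proof.
case: p q => [e u] [f v] [/= ee eu] [/= ff fv].
have qq := idem_iplus (Ibar i u * f).
split=> /=; first exact: idemM.
apply/ige_idem; first exact: idemM.
rewrite mulgA (idemC (idem_iplus _) ee) -mulgA; congr (e * _).
have uf : Ibar i u * f = Ibar i u * Ibar i v * ((Ibar i v)^-1 * f).
  by have /(ige_idem _ ff) {1}<- := fv; rewrite /iplus !mulgA.
have PUf : iplus (Ibar i (u ++ v)) * (Ibar i u * f) = Ibar i u * f.
  by rewrite uf mulgA iplus_bar_mul.
by rewrite /paction {2}/iplus mulgA PUf.
Qed.

Lemma pap_starP (p : I_ i X * seq X) :
  pap_set p -> pap_set (istar (p.1 * Ibar i p.2), [::]).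
Proof. by move=> _; split=> /=; [|apply: ige1]; exact: idem_istar. Qed.

Lemma pap_plusP (p : I_ i X * seq X) : pap_set p -> pap_set (p.1, [::]).
Proof. by case=> pp _; split=> //=; exact: ige1. Qed.

Lemma pap_maxP (p : I_ i X * seq X) :
  pap_set p -> pap_set (iplus (Ibar i p.2), p.2).
Proof.
move=> _; split=> /=; first exact: idem_iplus.
by apply/ige_idem; exact: idem_iplus.
Qed.

Lemma pap_oneP : pap_set (1 : I_ i X, [::] : seq X).
Proof.
have i1 : idem (1 : I_ i X) by rewrite /idem /= mulg1.
by split=> //=; exact: ige1.
Qed.

Lemma pap_genP x : pap_set (iplus (Ilett i x), [:: x]).
Proof.
split=> /=; first exact: idem_iplus.
apply/ige_idem; first exact: idem_iplus.
have xE : iplus (Ibar i [:: x]) * Ilett i x = Ilett i x.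
  by rewrite {1}(Ilett_ge x) mulgA iplus_mul; exact: esym (Ilett_ge x).
by rewrite {2}/iplus mulgA xE.
Qed.

(* E(I_i) x| X^*, where a pair is given by its value in I_i * X^*. *)
Definition PAP : Type := set_type (@pap_set i X).

Definition pap_of (p : I_ i X * seq X) (pP : pap_set p) : PAP :=
  exist _ p (mem_set pP).

Definition pap_val (a : PAP) : I_ i X * seq X := val a.

Lemma pap_valP (a : PAP) : pap_set (pap_val a).
Proof. exact: set_mem (valP a). Qed.

HB.instance Definition _ := hasMul.Build PAP
  (fun a b => pap_of (pap_mulP (pap_valP a) (pap_valP b))).
HB.instance Definition _ := hasOne.Build PAP (pap_of pap_oneP).
HB.instance Definition _ := hasBirestrictionOps.Build PAP
  (fun a => pap_of (pap_starP (pap_valP a)))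
  (fun a => pap_of (pap_plusP (pap_valP a)))
  (fun a => pap_of (pap_maxP (pap_valP a))).

Definition pap_gen x : PAP := pap_of (pap_genP x).

End PartialActionProduct.

(* Main.v *)
(* The product E(I_i) x| X^* lies in the variety, and it is generated by the   *)
(* pairs (x^+, x): (\bar u^+, u) is the maximum of a product of generators,    *)
(* and if (e, 1) is generated then so is ((a e)^+, 1), first for a letter a or  *)
(* its inverse, hence for every a in I_i.  For the inverse map, let S be in     *)
(* the variety.  S acts on its semilattice P(S) by the partial isomorphisms     *)
(* e |-> (s e)^+ between principal ideals, and x |-> x, \bar u |-> u^m respects *)
(* the relations N_i inside the inverse monoid of all such isomorphisms.  This  *)
(* sends each idempotent e of I_i to a projection r(e) of S, and                *)
(* (e, u) |-> r(e) u^m is a morphism extending the assignment of X.             *)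
From HB Require Import structures.
Require Import Defs.
From mathcomp Require Import all_boot.
From mathcomp Require Import boolp classical_sets.

Set Implicit Arguments.
Unset Strict Implicit.
Unset Printing Implicit Defensive.

Local Open Scope group_scope.

(** Once the product is known to lie in the variety ([pap_in_variety]), freeness gives a morphism h
    that sends generators to generators. It is onto because the pairs (x^+, x) generate the product
    ([pap_generated]). It is injective because any assignment of X in a member S of the variety
    extends to the product ([pap_ext_hom], [pap_ext_gen]): for S the free algebra, the extension g
    satisfies g h = id by uniqueness.

    All four presentations imply \bar u \bar v <= \overline{uv} ([Ibar_cat]). This drives the
    birestriction identities of the product, and each strength identity there comes from the
    matching relations of [N]. The difficulty in building g is to define a projection r(e) of S for
    an idempotent e of a presented inverse monoid, although S has no inverses. So S is replaced by
    its action on P(S) ([munn_rep]), by elements of the inverse monoid [munn]. The relations hold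
    there ([letter_value_rel]), e acts as multiplication by a projection, and this projection is
    r(e). *)

(** * Birestriction identities in an inverse monoid *)

Section InverseMonoidProjections.
Variable M : inverseMonoidType.
Implicit Types a b e f : M.

Lemma idem_one : idem (1 : M).
Proof. by rewrite /idem /= mulg1. Qed.

Lemma ige_mulr e f : idem f -> ige (iplus e) f -> f * iplus e = f.
Proof. by move=> ff /(ige_idem _ ff) fe; rewrite (idemC ff (idem_iplus _)). Qed.

Lemma mul_istar a : a * istar a = a.
Proof. by rewrite /istar mulgA mulgVKg. Qed.

Lemma iplus_mulr a b : iplus (a * b) = iplus (a * iplus b).
Proof.
transitivity (a * (iplus b * iplus b) * a^-1).
  by rewrite (idem_iplus b) /iplus invgM !mulgA.
by rewrite [RHS]/iplus invgM (idem_inv (idem_iplus b)) !mulgA.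
Qed.

Lemma istar_mull a b : istar (a * b) = istar (istar a * b).
Proof.
rewrite !(istar_iplus (_ * _)) (invgM a) (invgM (istar a)).
by rewrite (idem_inv (idem_istar a)) iplus_mulr istar_iplus.
Qed.

Lemma mul_idem a f : idem f -> a * f = iplus (a * f) * a.
Proof.
move=> ff; rewrite iplus_mulr (iplus_idem ff) /iplus invgM (idem_inv ff).
rewrite !mulgA -(mulgA a f f) ff -mulgA -mulgA -[_^-1 * a]/(istar a).
by rewrite (idemC ff (idem_istar a)) mulgA mul_istar.
Qed.

(** Dual of [mul_idem], obtained by taking inverses. *)
Lemma idem_mul e a : idem e -> e * a = a * istar (e * a).
Proof.
move=> ee; rewrite istar_iplus invgM (idem_inv ee).
apply: (can_inj invgK); rewrite (invgM e) (invgM a) (idem_inv ee) (idem_inv (idem_iplus _)).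
exact: mul_idem.
Qed.

Lemma iplus_idem_mul e a : idem e -> iplus (e * a) = e * iplus a.
Proof.
by move=> ee; rewrite iplus_mulr iplus_idem //; apply: idemM => //; exact: idem_iplus.
Qed.

Lemma istar_mul_idem a f : idem f -> istar (a * f) = istar a * f.
Proof.
by move=> ff; rewrite istar_mull istar_idem //; apply: idemM => //; exact: idem_istar.
Qed.

End InverseMonoidProjections.

(** * Products of barred words in I_i *)

Section Words.
Variables (i : strength) (X : Type).
Implicit Types (u v : seq X) (x : X).

Lemma Ibar_nil : Ibar i [::] = 1 :> I_ i X.
Proof. by []. Qed.

Lemma Ibar_left_strong u v : i = LeftStrong \/ i = Strong ->
  Ibar i u * Ibar i v = iplus (Ibar i u) * Ibar i (u ++ v).
Proof.
case: u => [|x u]; first by rewrite Ibar_nil iplus1 !mul1g.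
case: v => [|y v]; first by rewrite cats0 Ibar_nil mulg1 iplus_mul.
move=> iE; rewrite /Ibar -inv_class_iplus -!inv_classM; apply: inv_class_rel.
by case: iE => ->; [|left]; constructor.
Qed.

Lemma Ibar_right_strong u v : i = RightStrong \/ i = Strong ->
  Ibar i u * Ibar i v = Ibar i (u ++ v) * istar (Ibar i v).
Proof.
case: u => [|x u]; first by rewrite Ibar_nil mul1g mul_istar.
case: v => [|y v]; first by rewrite cats0 Ibar_nil istar_idem //; exact: idem_one.
move=> iE; rewrite /Ibar -inv_class_istar -!inv_classM; apply: inv_class_rel.
by case: iE => ->; [|right]; constructor.
Qed.

Lemma Ibar_perfect u v : i = Perfect -> Ibar i u * Ibar i v = Ibar i (u ++ v).
Proof.
case: u => [|x u]; first by rewrite Ibar_nil mul1g.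
case: v => [|y v]; first by rewrite cats0 Ibar_nil mulg1.
move=> iE; rewrite /Ibar -!inv_classM; apply/esym/inv_class_rel.
by rewrite iE; constructor.
Qed.

(** The consequence \bar u \bar v <= \overline{uv} shared by all four presentations; the
    birestriction identities of the product rest on it. *)
Lemma Ibar_cat u v :
  Ibar i u * Ibar i v = iplus (Ibar i u * Ibar i v) * Ibar i (u ++ v).
Proof.
have ls : i = LeftStrong \/ i = Strong ->
    Ibar i u * Ibar i v = iplus (Ibar i u * Ibar i v) * Ibar i (u ++ v).
  move=> /Ibar_left_strong ->; rewrite iplus_idem_mul; last exact: idem_iplus.
  by rewrite -[RHS]mulgA iplus_mul.
have [iE|iE|iE|iE] :
    [\/ i = LeftStrong, i = Strong, i = RightStrong | i = Perfect].
- by case: (i); [constructor 1|constructor 3|constructor 2|constructor 4].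
- by apply: ls; left.
- by apply: ls; right.
- rewrite Ibar_right_strong; last by left.
  by rewrite -mul_idem //; exact: idem_istar.
- by rewrite Ibar_perfect // iplus_mul.
Qed.

(** As f <= \bar v^+, also (\bar u f)^+ <= (\bar u \bar v)^+; now multiply [Ibar_cat] by (\bar u
    f)^+ on the left. *)
Lemma Ibar_cat_mul u v f : idem f -> f * iplus (Ibar i v) = f ->
  iplus (Ibar i u * f) * Ibar i (u ++ v) = Ibar i u * f * Ibar i v.
Proof.
move=> ff fv.
have -> : iplus (Ibar i u * f) = iplus (Ibar i u * f) * iplus (Ibar i u * Ibar i v).
  rewrite (iplus_mulr (Ibar i u) (Ibar i v)) -(iplus_idem_mul _ (idem_iplus _)).
  by rewrite [_ * (_ * _)]mulgA -mul_idem // -[_ * _ * iplus _]mulgA fv.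
by rewrite -[LHS]mulgA -Ibar_cat [LHS]mulgA -mul_idem.
Qed.

Lemma Ilett_plus x : Ilett i x = iplus (Ilett i x) * Ibar i [:: x].
Proof.
have /= xE := Ilett_ge i x; rewrite {2}xE -mul_idem //; exact: idem_istar.
Qed.

End Words.

(** * The partial action product lies in the variety *)

Section ProductInVariety.
Variables (i : strength) (X : Type).
Implicit Types (p q : PAP i X).

Lemma pap_eq p q : (pap_val p).1 = (pap_val q).1 -> (pap_val p).2 = (pap_val q).2 ->
  p = q.
Proof.
rewrite /pap_val; case: p q => [[e u] p] [[f v] q] /= ef uv.
by apply: val_inj; rewrite /= ef uv.
Qed.

Lemma pap_val_mul p q : pap_val (p * q) =
  ((pap_val p).1 * paction (pap_val p).2 (pap_val q).1, (pap_val p).2 ++ (pap_val q).2).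
Proof. by []. Qed.

Lemma pap_val_star p : pap_val (bstar p) =
  (istar ((pap_val p).1 * Ibar i (pap_val p).2), [::]).
Proof. by []. Qed.

Lemma pap_val_plus p : pap_val (bplus p) = ((pap_val p).1, [::]).
Proof. by []. Qed.

Lemma pap_val_max p : pap_val (bmax p) = (iplus (Ibar i (pap_val p).2), (pap_val p).2).
Proof. by []. Qed.

Definition pap_valE := (pap_val_mul, pap_val_star, pap_val_plus, pap_val_max).

Lemma pap_birestriction : birestriction_monoid (PAP i X).
Proof.
split=> [x y z|x|x|x|x y|x y|x y|x|x y|x y|x y|x|x]; apply: pap_eq => /=;
  rewrite ?cats0 ?catA // /paction ?Ibar_nil ?mul1g ?mulg1.
all: have [] := pap_valP x; move: (pap_val x) => [e u] /= ee /(ige_mulr ee) eu.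
all: try (have [] := pap_valP y; move: (pap_val y) => [f v] /= ff /(ige_mulr ff) fv).
(* Associativity: both sides are e times the range of \bar u f \bar v g. *)
- have [] := pap_valP z; move: (pap_val z) => [g w] /= gg gw.
  rewrite -[RHS]mulgA; congr (_ * _).
  rewrite -(iplus_idem_mul _ ff) -(iplus_mulr (Ibar i u)).
  by rewrite -(iplus_idem_mul _ (idem_iplus _)) !mulgA Ibar_cat_mul.
- by rewrite iplus_idem.
- exact: eu.
- rewrite -(iplus_idem_mul _ ee) [e * _]mulgA mul_istar.
  by rewrite (iplus_idem_mul _ ee).
- by rewrite !(iplus_idem (idem_istar _)) (idemC (idem_istar _) (idem_istar _)).
- have fI := idem_istar (f * Ibar i v).
  rewrite (iplus_idem fI) -[e * _ * _]mulgA -(mul_idem _ fI).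
  by rewrite [in LHS](mulgA e) (istar_mul_idem _ fI).
(* The identity x^* y = y (xy)^*: put k = (e \bar u)^* f. Both sides reduce to k, since \bar v (k
   \bar v)^* = k \bar v and k <= \bar v^+. *)
- rewrite (iplus_idem ff) -[e * _ * _]mulgA (Ibar_cat_mul _ ff) ?(mulgA e) //.
  have gI : idem (istar (e * Ibar i u) * f).
    by apply: idemM => //; exact: idem_istar.
  rewrite (istar_mull _ (Ibar i v)) (istar_mul_idem _ ff) -(idem_mul _ gI).
  rewrite (iplus_idem_mul _ gI) -[_ * f * _]mulgA fv mulgA.
  by rewrite (idemC ff (idem_istar _)) -[RHS]mulgA ff.
- by rewrite (iplus_idem ee).
- by rewrite (iplus_idem ee) (iplus_idem ff) idemC.
- by rewrite (iplus_idem ee) -[RHS]mulgA (idemC (idem_iplus _) ee) [RHS]mulgA ee.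
- by rewrite istar_idem.
Qed.

Lemma pap_F_birestriction : F_birestriction_monoid (PAP i X).
Proof.
apply/F_birestriction_equations; split=> [|x|x y]; first exact: pap_birestriction.
- apply: pap_eq => //=; rewrite /paction Ibar_nil mul1g.
  have [] := pap_valP x; move: (pap_val x) => [e u] /= ee /(ige_mulr ee) eu.
  by rewrite (iplus_idem (idem_iplus _)).
- by apply: pap_eq => /=; rewrite cats0.
Qed.

Lemma pap_left_strong : i = LeftStrong \/ i = Strong -> left_strong (PAP i X).
Proof.
move=> iE x y; apply: pap_eq => //=; rewrite /paction Ibar_nil mul1g.
rewrite -iplus_mulr (Ibar_left_strong _ _ iE) (iplus_idem (idem_iplus _)).
by rewrite (iplus_idem_mul _ (idem_iplus _)) mulgA (idem_iplus _).
Qed.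

Lemma pap_right_strong : i = RightStrong \/ i = Strong -> right_strong (PAP i X).
Proof.
move=> iE x y; apply: pap_eq; rewrite /= ?cats0 // /paction.
rewrite iplus_mul -iplus_mulr -(Ibar_right_strong _ _ iE).
by rewrite -!(iplus_idem_mul _ (idem_iplus _)) iplus_bar_mul mulgA iplus_mul.
Qed.

Lemma pap_perfect : i = Perfect -> perfect (PAP i X).
Proof.
move=> iE x y; apply: pap_eq => //=; rewrite /paction -iplus_mulr.
by rewrite -(iplus_idem_mul _ (idem_iplus _)) mulgA iplus_mul (Ibar_perfect _ _ iE).
Qed.

Lemma pap_in_variety : in_variety i (PAP i X).
Proof.
split; first exact: pap_F_birestriction.
have := pap_left_strong; have := pap_right_strong; have := pap_perfect.
case: (i) => /= p rs ls; first by apply: ls; left.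
- by apply: rs; left.
- by split; [apply: ls | apply: rs]; right.
- exact: p.
Qed.

End ProductInVariety.

(** * The pairs (x^+, x) generate the product *)

Section Generation.
Variables (i : strength) (X : Type) (H : PAP i X -> Prop).
Hypotheses (Hgen : forall x, H (pap_gen i x))
  (Hmul : forall p q, H p -> H q -> H (p * q))
  (Hstar : forall p, H p -> H (bstar p)) (Hplus : forall p, H p -> H (bplus p))
  (Hmax : forall p, H p -> H (bmax p)) (H1 : H 1).

Let G (e : I_ i X) (u : seq X) : Prop := exists2 p, H p & pap_val p = (e, u).

Let G_bar u : G (iplus (Ibar i u)) u.
Proof.
suff [p Hp pu] : exists2 p, H p & (pap_val p).2 = u.
  by exists (bmax p); [exact: Hmax | rewrite pap_valE pu].
elim: u => [|x u [p Hp pu]]; first by exists 1.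
by exists (pap_gen i x * p); [exact: Hmul | rewrite pap_val_mul pu].
Qed.

Let G_iplus_mul e f u : G f u -> G e [::] -> G (iplus (f * Ibar i u * e)) [::].
Proof.
move=> [p Hp pE] [q Hq qE]; exists (bplus (p * q)); first exact/Hplus/Hmul.
have [ff _] := pap_valP p; rewrite !pap_valE pE qE /= in ff *.
by rewrite /paction -[f * _ * e]mulgA (iplus_idem_mul _ ff).
Qed.

Let G_istar_mul e f u : G f u -> G e [::] -> G (iplus ((f * Ibar i u)^-1 * e)) [::].
Proof.
move=> [p Hp pE] [q Hq qE]; exists (bstar (q * p)); first exact/Hstar/Hmul.
have [ff _] := pap_valP p; have [ee _] := pap_valP q; rewrite !pap_valE pE qE /= in ff ee *.
rewrite /paction Ibar_nil mul1g (iplus_idem ff) istar_iplus.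
by rewrite -(mulgA e f) (invgM e) (idem_inv ee).
Qed.

(** A term and its inverse are treated together because [IInv] swaps the two claims; e varies
    because (s t e)^+ = (s (t e)^+)^+. *)
Let G_term t e : G e [::] ->
  G (iplus (inv_class (@N i X) t * e)) [::] /\
  G (iplus ((inv_class (@N i X) t)^-1 * e)) [::].
Proof.
elim: t e => [a|s IHs t IHt|s IHs|] e Ge.
(* Every letter is f \bar u with (f, u) generated: x = x^+ \bar x and \bar u = \bar u^+ \bar u. *)
- have [f [u [Gf ->]]] : exists f u, G f u /\ inv_class (@N i X) (IVar a) = f * Ibar i u.
    case: a => [x|x w].
      exists (iplus (Ilett i x)), [:: x]; split; first by exists (pap_gen i x).
      exact: Ilett_plus.
    exists (iplus (Ibar i (x :: w))), (x :: w); split; first exact: G_bar.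
    by rewrite iplus_mul.
  by split; [exact: G_iplus_mul | exact: G_istar_mul].
- rewrite -[IMul s t]/(s * t) inv_classM; split.
    rewrite -[_ * _ * e]mulgA iplus_mulr; apply: (IHs _ _).1.
    by apply: (IHt _ _).1.
  rewrite (invgM (inv_class _ s)) -[_ * _ * e]mulgA iplus_mulr; apply: (IHt _ _).2.
  by apply: (IHs _ _).2.
- rewrite -[IInv s]/(s^-1) inv_classV invgK.
  by split; [apply: (IHs _ _).2 | apply: (IHs _ _).1].
- rewrite -[IOne]/1 inv_class1 invg1 mul1g.
  case: Ge => p Hp pE; have [/= ee _] := pap_valP p; rewrite pE /= in ee.
  by split; exists p; rewrite // (iplus_idem ee).
Qed.

Lemma pap_generated p : H p.
Proof.
have G1 : G 1 [::] by exists 1.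
have [ee /(ige_mulr ee) eu] := pap_valP p.
(* For an idempotent e, (e 1)^+ = e, so (e, 1) is generated; then (e, u) = (e, 1)(\bar u^+, u)
   because e <= \bar u^+. *)
have [[q Hq qE] _] := G_term (repr (pap_val p).1) G1.
rewrite -[inv_class _ _]/(\pi_(Inv (@N i X)) _)%qT reprK mulg1 (iplus_idem ee) in qE.
have [r Hr rE] := G_bar (pap_val p).2.
suff -> : p = q * r by exact: Hmul.
apply: pap_eq; rewrite pap_val_mul qE rE //= /paction Ibar_nil mul1g.
by rewrite (iplus_idem (idem_iplus _)).
Qed.

End Generation.

(** * The inverse monoid of isomorphisms between principal ideals of a semilattice *)

HB.mixin Record Monoid_isSemilattice L of Monoid L := {
  slmulC : forall a b : L, a * b = b * a;
  slmulxx : forall a : L, a * a = a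
}.

#[short(type="semilatticeType")]
HB.structure Definition Semilattice := {L of Monoid_isSemilattice L & Monoid L}.

(* An isomorphism between the principal ideals of minv 1 and mfun 1, extended *)
(* to L by mfun a = mfun (a * minv 1), so that composition is total.          *)
Record munn (L : semilatticeType) := Munn {
  mfun : L -> L;
  minv : L -> L;
  mfunM : {morph mfun : a b / a * b};
  minvM : {morph minv : a b / a * b};
  mfunK : forall a, mfun (minv a) = a * mfun 1;
  minvK : forall a, minv (mfun a) = a * minv 1
}.

Section MunnMonoid.
Variable L : semilatticeType.
Implicit Types g h k : munn L.

HB.instance Definition _ := gen_eqMixin (munn L).
HB.instance Definition _ := gen_choiceMixin (munn L).

Lemma munn_eq g h : mfun g =1 mfun h -> minv g =1 minv h -> g = h.
Proof.
case: g h => [g g' gM gM' gK gK'] [h h' hM hM' hK hK'] /= /funext gh /funext gh'.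
by subst h h'; congr Munn; exact: Prop_irrelevance.
Qed.

(** Serves both cancellation laws of a composite: the second is this one for the inverses in reverse
    order. *)
Lemma munn_mul_subproof g h a :
  mfun g (mfun h (minv h (minv g a))) = a * mfun g (mfun h 1).
Proof. by rewrite mfunK mfunM mfunK -mulgA -mfunM mul1g. Qed.

Definition munn_inv g : munn L := Munn (@minvM _ g) (@mfunM _ g) (@minvK _ g) (@mfunK _ g).

Definition munn_mul g h : munn L.
Proof.
exists (mfun g \o mfun h) (minv h \o minv g) => [a b|a b|a|a] /=.
- by rewrite !mfunM.
- by rewrite !minvM.
- exact: munn_mul_subproof.
- exact: (munn_mul_subproof (munn_inv h) (munn_inv g)).
Defined.

Definition munn_one : munn L.
Proof. by exists id id => //= a; rewrite mulg1. Defined.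

Lemma munn_mulA : associative munn_mul.
Proof. by move=> g h k; exact: munn_eq. Qed.

Lemma munn_mul1 : left_id munn_one munn_mul.
Proof. by move=> g; exact: munn_eq. Qed.

Lemma munn_mulx1 : right_id munn_one munn_mul.
Proof. by move=> g; exact: munn_eq. Qed.

Lemma munn_invK : involutive munn_inv.
Proof. by move=> g; exact: munn_eq. Qed.

Lemma munn_invM : {morph munn_inv : g h / munn_mul g h >-> munn_mul h g}.
Proof. by move=> g h; exact: munn_eq. Qed.

HB.instance Definition _ := isMonoid.Build (munn L) munn_mulA munn_mul1 munn_mulx1.
HB.instance Definition _ := hasInv.Build (munn L) munn_inv.
HB.instance Definition _ := Monoid_isStarMonoid.Build (munn L) munn_invK munn_invM.

Lemma munn_mulVK g : g * g^-1 * g = g.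
Proof.
apply: munn_eq => a /=; first by rewrite mfunK -mfunM mulg1.
by rewrite minvK -minvM mulg1.
Qed.

(** By [mfunK], g g^-1 is multiplication by [mfun g 1], and multiplications of a semilattice
    commute. *)
Lemma munn_mulVC g h : commute (g * g^-1) (h * h^-1).
Proof.
by apply: munn_eq => a /=; rewrite !mfunK -!mulgA (slmulC (mfun h 1)).
Qed.

HB.instance Definition _ := StarMonoid_isInverse.Build (munn L) munn_mulVK munn_mulVC.

Lemma mfun_mul g h a : mfun (g * h) a = mfun g (mfun h a).
Proof. by []. Qed.

Lemma mfun_inv g : mfun g^-1 = minv g.
Proof. by []. Qed.

Lemma mfun_iplus g a : mfun (iplus g) a = a * mfun g 1.
Proof. exact: mfunK. Qed.

Lemma mfun_iplus1 g : mfun (iplus g) 1 = mfun g 1.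
Proof. by rewrite mfun_iplus mul1g. Qed.

End MunnMonoid.

(** * The action of a birestriction monoid on its projections *)

Section BirestrictionTheory.
Variables (S : fbrAlgType) (bS : birestriction_monoid S).
Implicit Types s t : S.

Lemma bstar_star s : bstar (bstar s) = bstar s.
Proof. by rewrite -{1}(bstar_plus bS s) (bplus_star bS) (bstar_plus bS). Qed.

Lemma bplus_mulr s t : bplus (s * bplus t) = bplus (s * t).
Proof.
rewrite (bmul_plus bS) (bplusM bS) (bplusC bS) -(bplusM bS) (bmulA bS).
by rewrite (bplus_mul bS).
Qed.

Lemma bstar_mull s t : bstar (bstar s * t) = bstar (s * t).
Proof.
rewrite (bstar_mul bS) (bstarM bS) (bstarC bS) -(bstarM bS) -(bmulA bS).
by rewrite (bmul_star bS).
Qed.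

(** The type carries the proof of the axioms, so that the semilattice laws can be attached to it as
    canonical instances. *)
Definition projections (_ : birestriction_monoid S) : Type := set_type (@proj S).
Local Notation P := (projections bS).

HB.instance Definition _ := gen_eqMixin P.
HB.instance Definition _ := gen_choiceMixin P.

Definition bstar_proj s : P := exist _ (bstar s) (mem_set (imageT (@bstar S) s)).

Lemma bplus_proj_subproof s : bplus s \in @proj S.
Proof. by apply: mem_set; exists (bplus s) => //; rewrite (bplus_star bS). Qed.

Definition bplus_proj s : P := exist _ (bplus s) (bplus_proj_subproof s).

Definition pval (e : P) : S := val e.

Lemma bplus_projE s : pval (bplus_proj s) = bplus s.
Proof. by []. Qed.

Lemma bstar_projE s : pval (bstar_proj s) = bstar s.
Proof. by []. Qed.

Lemma pval_inj : injective pval. Proof. exact: val_inj. Qed.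

Lemma bstar_pval (e : P) : bstar (pval e) = pval e.
Proof.
by have [s _ sE] := set_mem (valP e); rewrite /pval -sE bstar_star.
Qed.

Lemma bplus_pval (e : P) : bplus (pval e) = pval e.
Proof. by rewrite -bstar_pval (bstar_plus bS). Qed.

Lemma pval_idem (e : P) : pval e * pval e = pval e.
Proof. by rewrite -{2}(bstar_pval e) (bmul_star bS). Qed.

Lemma pvalC (e f : P) : pval e * pval f = pval f * pval e.
Proof. by rewrite -(bstar_pval e) -(bstar_pval f) (bstarC bS). Qed.

Lemma bplus1 : bplus 1 = 1 :> S.
Proof. by rewrite -[LHS](bmulx1 bS) (bplus_mul bS). Qed.

(** Taking [bplus] makes the result a projection by construction; by [pval_mul] it does not change
    the product. *)
Definition proj_mul (e f : P) : P := bplus_proj (pval e * pval f).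
Definition proj_one : P := bplus_proj 1.

Lemma pval_mul e f : pval (proj_mul e f) = pval e * pval f.
Proof.
rewrite -[LHS]/(bplus (pval e * pval f)) -[in LHS](bplus_pval e) (bplusM bS).
by rewrite !bplus_pval.
Qed.

Lemma pval_one : pval proj_one = 1.
Proof. exact: bplus1. Qed.

Lemma proj_mulA : associative proj_mul.
Proof. by move=> e f g; apply: pval_inj; rewrite !pval_mul (bmulA bS). Qed.

Lemma proj_mul1 : left_id proj_one proj_mul.
Proof. by move=> e; apply: pval_inj; rewrite pval_mul pval_one (bmul1 bS). Qed.

Lemma proj_mulx1 : right_id proj_one proj_mul.
Proof. by move=> e; apply: pval_inj; rewrite pval_mul pval_one (bmulx1 bS). Qed.

HB.instance Definition _ := isMonoid.Build P proj_mulA proj_mul1 proj_mulx1.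

Lemma proj_mulC (e f : P) : e * f = f * e.
Proof. by apply: pval_inj; rewrite !pval_mul pvalC. Qed.

Lemma proj_mulxx (e : P) : e * e = e.
Proof. by apply: pval_inj; rewrite pval_mul pval_idem. Qed.

HB.instance Definition _ := Monoid_isSemilattice.Build P proj_mulC proj_mulxx.

Definition pvalM : {morph pval : e f / (e : P) * f >-> e * f} := pval_mul.
Definition pval1 : pval 1 = 1 := pval_one.

Lemma pval_mulE e s : pval e * s = s * bstar (pval e * s).
Proof. by rewrite -(bstar_mul bS) bstar_pval. Qed.

Lemma mul_pvalE s e : s * pval e = bplus (s * pval e) * s.
Proof. by rewrite -(bmul_plus bS) bplus_pval. Qed.

Definition munn_rep s : munn P.
Proof.
exists (fun e => bplus_proj (s * pval e)) (fun e => bstar_proj (pval e * s))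
  => [e f|e f|e|e]; apply: pval_inj;
  rewrite ?(pvalM, pval1, bplus_projE, bstar_projE) ?(bmulx1 bS) ?(bmul1 bS).
- rewrite (bmulA bS) -[in LHS](bplus_pval e) (bmul_plus bS) -(bmulA bS).
  by rewrite (bplusM bS).
- by rewrite -(bmulA bS) [in LHS](pval_mulE f) (bmulA bS) (bstarM bS).
- by rewrite -pval_mulE -[in LHS](bplus_pval e) (bplusM bS) bplus_pval.
- rewrite -(bmul_plus bS) bplus_pval -(bstar_pval e).
  by rewrite (bstarM bS) (bstarC bS).
Defined.

Lemma mfun_rep s (e : P) : pval (mfun (munn_rep s) e) = bplus (s * pval e).
Proof. by []. Qed.

Lemma minv_rep s (e : P) : pval (minv (munn_rep s) e) = bstar (pval e * s).
Proof. by []. Qed.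

Lemma munn_repM s t : munn_rep (s * t) = munn_rep s * munn_rep t.
Proof.
apply: munn_eq => e; apply: pval_inj.
  by rewrite mfun_mul !mfun_rep -(bmulA bS) bplus_mulr.
rewrite -[minv (_ * _) e]/(minv (munn_rep t) (minv (munn_rep s) e)) !minv_rep.
by rewrite (bmulA bS) bstar_mull.
Qed.

Lemma munn_rep1 : munn_rep 1 = 1.
Proof.
apply: munn_eq => e; apply: pval_inj.
  by rewrite mfun_rep (bmul1 bS) bplus_pval.
by rewrite minv_rep (bmulx1 bS) bstar_pval.
Qed.

(** Both sides act, in both directions, as multiplication by s^+. *)
Lemma munn_rep_plus s : munn_rep (bplus s) = iplus (munn_rep s).
Proof.
suff sE e : pval (mfun (munn_rep (bplus s)) e) = pval (mfun (iplus (munn_rep s)) e) /\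
    pval (minv (munn_rep (bplus s)) e) = pval (mfun (iplus (munn_rep s)) e).
  by apply: munn_eq => e; apply: pval_inj; case: (sE e).
rewrite mfun_rep minv_rep mfun_iplus pvalM mfun_rep pval1 (bmulx1 bS).
split; first by rewrite (bplusM bS) bplus_pval -(bplus_pval e) (bplusC bS).
by rewrite -(bplus_star bS s) (bstarM bS) bstar_pval.
Qed.

Lemma munn_rep_star s : munn_rep (bstar s) = istar (munn_rep s).
Proof.
suff sE e : pval (mfun (munn_rep (bstar s)) e) = pval (mfun (istar (munn_rep s)) e) /\
    pval (minv (munn_rep (bstar s)) e) = pval (mfun (istar (munn_rep s)) e).
  by apply: munn_eq => e; apply: pval_inj; case: (sE e).
rewrite istar_iplus mfun_rep minv_rep mfun_iplus pvalM mfun_inv minv_rep pval1 (bmul1 bS).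
split; last by rewrite (bstarM bS) bstar_pval.
by rewrite -(bstar_plus bS s) (bplusM bS) bplus_pval -(bplus_pval e) (bplusC bS).
Qed.

End BirestrictionTheory.

(** * Extending an assignment of X to the product *)

Section Extension.
Variables (i : strength) (X : Type) (S : fbrAlgType) (VS : in_variety i S) (f : X -> S).
Implicit Types (u v : seq X) (a b : I_ i X) (p q : PAP i X) (s t : S).

Let bS : birestriction_monoid S := VS.1.1.
Let FS := (F_birestriction_equations S).1 VS.1.

Lemma bplus_max s : bplus s * bmax s = s.
Proof. by case: FS. Qed.

Lemma bmax_mul_proj s (e : projections bS) : bmax (s * pval e) = bmax s.
Proof. by rewrite -bstar_pval; case: FS. Qed.

Lemma bmax_max s : bmax (bmax s) = bmax s.
Proof.
rewrite -{2}(bplus_max s) -[bplus s]/(pval (bplus_proj bS s)) pval_mulE.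
by rewrite -[bstar _]/(pval (bstar_proj bS _)) bmax_mul_proj.
Qed.

Lemma bmax1 : bmax 1 = 1 :> S.
Proof. by rewrite -[LHS](bmul1 bS) -{1}(bplus1 bS) bplus_max. Qed.

Definition word_value u : S := foldr (fun x s => f x * s) 1 u.

Lemma word_value_cat u v : word_value (u ++ v) = word_value u * word_value v.
Proof. by elim: u => [|x u /= ->]; rewrite ?(bmul1 bS) ?(bmulA bS). Qed.

Definition word_max u : S := bmax (word_value u).

(** Counterpart of [Ibar_cat] in S, again common to the four varieties. *)
Lemma word_max_cat u v :
  word_max u * word_max v = bplus (word_max u * word_max v) * word_max (u ++ v).
Proof.
have ls : left_strong S ->
    word_max u * word_max v = bplus (word_max u * word_max v) * word_max (u ++ v).
  move=> ls; rewrite /word_max word_value_cat ls (bplusM bS) -(bmulA bS).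
  by rewrite (bplus_mul bS).
have := VS.2; case: (i) => /= [/ls //|rs|[/ls //]|p].
- rewrite /word_max word_value_cat rs.
  exact: (mul_pvalE _ (bstar_proj bS (bmax (word_value v)))).
- by rewrite /word_max word_value_cat p (bplus_mul bS).
Qed.

Definition letter_value (l : letter X) : munn (projections bS) :=
  match l with
  | Letter x => munn_rep bS (f x)
  | Bar x w => munn_rep bS (word_max (x :: w))
  end.

Lemma inv_eval_bar u : inv_eval letter_value (bar u) = munn_rep bS (word_max u).
Proof. by case: u => [|x u] //=; rewrite /word_max /= bmax1 munn_rep1. Qed.

Lemma letter_value_ge x : munn_rep bS (f x) =
  munn_rep bS (word_max [:: x]) * istar (munn_rep bS (f x)).
Proof.
rewrite -munn_rep_star -munn_repM /word_max /= (bmulx1 bS); congr munn_rep.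
rewrite -{1}(bplus_max (f x)) -[bplus _]/(pval (bplus_proj bS (f x))) pval_mulE.
by rewrite [pval _ * _]bplus_max.
Qed.

(** [munn_rep] preserves products, + and *, so each multiplicative relation is the image of the
    strength identity at the values of u and v. *)
Lemma letter_value_rel (c d : invterm (letter X)) :
  N i c d -> inv_eval letter_value c = inv_eval letter_value d.
Proof.
have ls (c' d' : invterm (letter X)) : left_strong S -> N_ls c' d' ->
    inv_eval letter_value c' = inv_eval letter_value d'.
  move=> ls [x|u v _ _] /=; first exact: letter_value_ge.
  rewrite !inv_eval_bar -[_ * _^-1]/(iplus (munn_rep bS (word_max u))).
  by rewrite -munn_rep_plus -!munn_repM /word_max word_value_cat ls.
have rs (c' d' : invterm (letter X)) : right_strong S -> N_rs c' d' ->
    inv_eval letter_value c' = inv_eval letter_value d'.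
  move=> rs [x|u v _ _] /=; first exact: letter_value_ge.
  rewrite !inv_eval_bar -[_^-1 * _]/(istar (munn_rep bS (word_max v))).
  by rewrite -munn_rep_star -!munn_repM /word_max word_value_cat rs.
have := VS.2; case: (i) => /= [|||p].
- exact: ls.
- exact: rs.
- by move=> [Sl Sr] [|]; [exact: ls | exact: rs].
- case=> [x|u v _ _] /=; first exact: letter_value_ge.
  by rewrite !inv_eval_bar -!munn_repM /word_max word_value_cat p.
Qed.

Definition munn_ext a : munn (projections bS) := inv_eval letter_value (repr a).

Lemma munn_ext_class (c : invterm (letter X)) :
  munn_ext (inv_class (@N i X) c) = inv_eval letter_value c.
Proof. by apply: (Inv_universal letter_value_rel); exact: reprK. Qed.

Lemma munn_extM : {morph munn_ext : a b / a * b}.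
Proof.
elim/Inv_ind=> c; elim/Inv_ind=> d.
by rewrite -inv_classM !munn_ext_class.
Qed.

Lemma munn_extV a : munn_ext a^-1 = (munn_ext a)^-1.
Proof. by elim/Inv_ind: a => c; rewrite -inv_classV !munn_ext_class. Qed.

Lemma munn_ext_iplus a : munn_ext (iplus a) = iplus (munn_ext a).
Proof. by rewrite /iplus munn_extM munn_extV. Qed.

Lemma munn_ext1 : munn_ext 1 = 1.
Proof. by rewrite -[1]inv_class1 munn_ext_class. Qed.

Lemma munn_ext_bar u : munn_ext (Ibar i u) = munn_rep bS (word_max u).
Proof. by rewrite munn_ext_class inv_eval_bar. Qed.

Lemma munn_ext_lett x : munn_ext (Ilett i x) = munn_rep bS (f x).
Proof. by rewrite munn_ext_class. Qed.

(* The projection of S that corresponds to a a^-1. *)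
Definition range_proj a : projections bS := mfun (munn_ext a) 1.

Lemma range_proj_iplus a : range_proj (iplus a) = range_proj a.
Proof. by rewrite /range_proj munn_ext_iplus mfun_iplus1. Qed.

Lemma mfun_idem e (a : projections bS) : idem e -> mfun (munn_ext e) a = a * range_proj e.
Proof. by move=> ee; rewrite -{1}(iplus_idem ee) munn_ext_iplus mfun_iplus. Qed.

Lemma range_projM e a : idem e -> range_proj (e * a) = range_proj e * range_proj a.
Proof.
move=> ee; rewrite /range_proj munn_extM mfun_mul -[mfun _ 1]/(range_proj a).
by rewrite mfun_idem // slmulC.
Qed.

Lemma range_proj_bar u e : idem e ->
  pval (range_proj (Ibar i u * e)) = bplus (word_max u * pval (range_proj e)).
Proof. by move=> ee; rewrite /range_proj munn_extM mfun_mul munn_ext_bar mfun_rep. Qed.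

Lemma range_proj_istar e u : idem e ->
  pval (range_proj (istar (e * Ibar i u))) = bstar (pval (range_proj e) * word_max u).
Proof.
move=> ee; rewrite istar_iplus range_proj_iplus invgM (idem_inv ee).
rewrite /range_proj munn_extM mfun_mul munn_extV mfun_inv munn_ext_bar minv_rep.
by rewrite mfun_idem // mul1g.
Qed.

Lemma range_proj1 : pval (range_proj 1) = 1.
Proof. by rewrite /range_proj munn_ext1 pval1. Qed.

Definition pap_ext p : S := pval (range_proj (pap_val p).1) * word_max (pap_val p).2.

Lemma pap_ext_hom : fbr_hom pap_ext.
Proof.
have wm1 : word_max [::] = 1 by exact: bmax1.
have maxE (e : projections bS) u : bmax (pval e * word_max u) = word_max u.
  by rewrite pval_mulE -[bstar _]/(pval (bstar_proj bS _)) bmax_mul_proj bmax_max.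
split=> [p q|p|p|p|]; rewrite /pap_ext ?pap_valE /=.
- have [] := pap_valP p; move: (pap_val p) => [e u] /= ee _.
  have [] := pap_valP q; move: (pap_val q) => [g v] /= gg /(ige_mulr gg) gv.
  (* The constraint g <= \bar v^+ passes to S as r(g) <= (v^m)^+. Hence (u^m r(g))^+ <= (u^m v^m)^+,
     and [word_max_cat] turns u^m r(g) v^m into (u^m r(g))^+ (uv)^m. *)
  have rgv : pval (range_proj g) * bplus (word_max v) = pval (range_proj g).
    rewrite -{2}gv range_projM // pvalM range_proj_iplus -[Ibar i v]mulg1.
    by rewrite (range_proj_bar _ (idem_one _)) range_proj1 (bmulx1 bS).
  have rguv : bplus (word_max u * pval (range_proj g)) * bplus (word_max u * word_max v)
      = bplus (word_max u * pval (range_proj g)).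
    by rewrite -(bplusM bS) (bmulA bS) -mul_pvalE -(bplus_mulr bS) -(bmulA bS) rgv.
  rewrite range_projM // pvalM range_proj_iplus range_proj_bar //.
  rewrite -[RHS](bmulA bS) [in RHS](bmulA bS (word_max u)) [in RHS]mul_pvalE.
  rewrite -[in RHS](bmulA bS (bplus _)) word_max_cat [in RHS](bmulA bS (bplus _)).
  by rewrite rguv (bmulA bS).
- have [] := pap_valP p; move: (pap_val p) => [e u] /= ee _.
  by rewrite wm1 (bmulx1 bS) range_proj_istar.
- have [] := pap_valP p; move: (pap_val p) => [e u] /= ee /(ige_mulr ee) eu.
  (* (r(e) u^m)^+ = r(e) (u^m)^+, which is r(e) because e <= \bar u^+. *)
  rewrite wm1 (bmulx1 bS) -[in RHS]bplus_pval (bplusM bS) bplus_pval.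
  rewrite -{1}eu range_projM // pvalM range_proj_iplus -[Ibar i u]mulg1.
  by rewrite (range_proj_bar _ (idem_one _)) range_proj1 (bmulx1 bS).
- rewrite maxE range_proj_iplus -[Ibar i _]mulg1 (range_proj_bar _ (idem_one _)).
  by rewrite range_proj1 (bmulx1 bS) (bplus_mul bS).
- by rewrite range_proj1 wm1 (bmulx1 bS).
Qed.

Lemma pap_ext_gen x : pap_ext (pap_gen i x) = f x.
Proof.
rewrite /pap_ext /= range_proj_iplus /range_proj munn_ext_lett mfun_rep pval1.
by rewrite (bmulx1 bS) /word_max /= (bmulx1 bS) bplus_max.
Qed.

End Extension.

(** * The isomorphism *)

Theorem theorem9p6 (X : Type) (X_nonempty : inhabited X) (i : strength) :
  exists h : FFBR i X -> PAP i X,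
    [/\ fbr_hom h, bijective h & forall x : X, h (ffbr_gen i x) = pap_gen i x].
Proof.
have [VF freeF] := ffbr_free i X.
have [h [[hh hgen] _]] := freeF (PAP i X) (@pap_gen i X) (pap_in_variety i X).
have := pap_ext_hom VF (@ffbr_gen i X); have := pap_ext_gen VF (@ffbr_gen i X).
move: (pap_ext VF _) => g ggen gh.
(* g h and the identity are endomorphisms of the free algebra that fix the generators. *)
have hK : cancel h g.
  have [k [_ k_uniq]] := freeF (FFBR i X) (@ffbr_gen i X) VF.
  have idE : k = id by apply: k_uniq.
  suff ghE : k = g \o h by move=> a; rewrite -[LHS]/((g \o h) a) -ghE idE.
  apply: k_uniq; split=> [|x]; last by rewrite /= hgen ggen.
  by split=> [a b|a|a|a|] /=;
    rewrite ?(fbr_homM hh, fbr_hom_star hh, fbr_hom_plus hh, fbr_hom_max hh, fbr_hom1 hh)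
      ?(fbr_homM gh, fbr_hom_star gh, fbr_hom_plus gh, fbr_hom_max gh, fbr_hom1 gh).
(* The image of h is a subalgebra that contains all generators of the product. *)
have h_surj p : exists a, h a = p.
  apply: (@pap_generated i X (fun q => exists a, h a = q)).
  - by move=> x; exists (ffbr_gen i x).
  - by move=> _ _ [a <-] [b <-]; exists (a * b); rewrite (fbr_homM hh).
  - by move=> _ [a <-]; exists (bstar a); rewrite (fbr_hom_star hh).
  - by move=> _ [a <-]; exists (bplus a); rewrite (fbr_hom_plus hh).
  - by move=> _ [a <-]; exists (bmax a); rewrite (fbr_hom_max hh).
  - by exists 1; rewrite (fbr_hom1 hh).
exists h; split=> //; exists g => // p.
by have [a <-] := h_surj p; rewrite hK.
Qed.
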